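(* Let $d\ge 2$ and $k\in\{0,\ldots,d-1\}$. Then the skeleton of the Wythoffian $\alpha_d(\{k\})$ coincides with (is isomorphic to) the Johnson graph $J(d+1,k+1)$.
   Context: Complexes. A flag in a poset is a totally ordered subset. A connected poset $\mathcal{K}$ is an $n$-complex if every maximal flag has size $n+1$; each element (face) $x$ then has a dimension $\dim(x)\in\{0,\dots,n\}$, where minimal elements have dimension $0$ and $\dim(y)=\dim(x)+1$ whenever $y$ covers $x$. An $n$-complex is a polytope if every flag of size $n$ is contained in exactly two maximal flags; then each $1$-face (edge) lies above exactly two $0$-faces (vertices). The skeleton of a polytope is the graph formed by its vertices and edges. Wythoff construction. Let $\mathcal{K}$ be an $n$-complex and $\Delta=\{0,\dots,n\}$. The type of a flag $F$ is $t(F)=\{\dim(x): x\in F\}\subseteq\Delta$. Fix a nonempty $V\subseteq\Delta$. For nonempty $U,U'\subseteq\Delta$ write $U'\le U$ if for all $u\in U$, $v\in V$ there is $u'\in U'$ with $u\le u'\le v$ or $u\ge u'\ge v$. This is a preorder; write $U\sim U'$ if $U\le U'$ and $U'\le U$, and $U'<U$ if $U'\le U$ but $U\not\le U'$. Each $\sim$-class $[U]$ has a unique smallest (under inclusion) member $m([U])$ and a unique largest member $M([U])$; the sets $m([U])$ are called essential. The Wythoffian $\mathcal{K}(V)$ is the poset of all flags $F$ of $\mathcal{K}$ whose type is essential, with $F'<F$ iff $t(F')<t(F)$ and $F\cup F'$ is a flag. It is again an $n$-complex, with $\dim(F)=n+1-|M([t(F)])|$, and is a polytope if $\mathcal{K}$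 is. The simplex $\alpha_d$ is the $(d-1)$-complex whose faces are all proper nonempty subsets $X$ of $\{1,\dots,d+1\}$, ordered by inclusion, with $\dim X=|X|-1$. The Johnson graph $J(m,n)$ has as vertices all $x\in\{0,1\}^m$ with $\sum_i x_i=n$, two vertices being adjacent if their Hamming distance is $2$. *)

(* Defs.v *)
From HB Require Import structures.
From mathcomp Require Import all_boot all_order.
From mathcomp Require Import zify.

Set Implicit Arguments.
Unset Strict Implicit.
Unset Printing Implicit Defensive.

Import Order.TTheory.
Local Open Scope order_scope.

Section Flags.
Context {disp : Order.disp_t} {T : finPOrderType disp}.

Definition flag (F : {set T}) : bool :=
  [forall x in F, forall y in F, x >=< y].

(* The height of [x], i.e. one less than the largest size of a flag of elements
   below or equal to [x].  In an n-complex this is the unique function that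
   vanishes on minimal elements and increases by one along covers. *)
Definition dim (x : T) : nat :=
  (\max_(F : {set T} | flag F && [forall y in F, y <= x]) #|F|).-1.

Lemma flagP (F : {set T}) : reflect {in F &, forall x y, x >=< y} (flag F).
Proof.
apply: (iffP forall_inP) => [fF x y xF yF | fF x xF].
  exact: (forall_inP (fF x xF)).
by apply/forall_inP => y yF; apply: fF.
Qed.

Lemma dim_witness (x : T) :
  exists2 F : {set T}, flag F & [/\ #|F| = (dim x).+1 & {in F, forall y, y <= x}].
Proof.
pose P := [pred F : {set T} | flag F && [forall y in F, y <= x]].
have P1 : [set x] \in P.
  rewrite inE; apply/andP; split; first by apply/flagP => y z /set1P-> /set1P->; exact: comparablexx.
  by apply/forall_inP => y /set1P->.
have P_gt0 : (0 < #|P|)%N by apply/card_gt0P; exists [set x].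
have [F PF maxF] := eq_bigmax_cond (fun F : {set T} => #|F|) P_gt0.
have /andP[fF /forall_inP leF] := PF; exists F => //; split=> //.
have dimE : dim x = #|F|.-1 by rewrite -maxF.
rewrite dimE prednK // -maxF (leq_trans _ (leq_bigmax_cond _ P1)) //.
by rewrite cards1.
Qed.

Lemma leq_dim (x : T) (F : {set T}) :
  flag F -> {in F, forall y, y <= x} -> (#|F| <= (dim x).+1)%N.
Proof.
move=> fF leF; have PF : flag F && [forall y in F, y <= x].
  by rewrite fF; apply/forall_inP.
apply: leq_trans (leqSpred _).
exact: (@leq_bigmax_cond _ (fun F => flag F && [forall y in F, y <= x])
          (fun F : {set T} => #|F|) F).
Qed.

Lemma lt_dim (x y : T) : x < y -> (dim x < dim y)%N.
Proof.
move=> xy; have [F fF [cF leF]] := dim_witness x.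
have yNF : y \notin F.
  by apply/negP => /leF /(lt_le_trans xy); rewrite ltxx.
have leF' : {in y |: F, forall z, z <= y}.
  by move=> z /setU1P[->//|/leF zx]; exact: le_trans zx (ltW xy).
have /leq_dim/(_ leF') : flag (y |: F).
  apply/flagP => z t /setU1P[->|zF] tF; first by rewrite comparable_sym le_comparable ?leF'.
  case/setU1P: tF => [->|tF]; last exact: (flagP F fF).
  by rewrite le_comparable ?leF' ?setU1r.
by rewrite cardsU1 yNF cF.
Qed.

End Flags.

HB.mixin Record isComplex (n : nat) (disp : Order.disp_t) T
    of Order.FinPOrder disp T := {
  connect_comparable : forall x y : T, connect (fun z t : T => z >=< t) x y;
  card_maxflag : forall F : {set T}, maxset flag F -> #|F| = n.+1
}.

#[short(type="complexType")]
HB.structure Definition Complex (n : nat) (disp : Order.disp_t) :=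
  { T of Order.FinPOrder disp T & isComplex n disp T }.

Lemma dim_complex n disp (K : complexType n disp) (x : K) : (dim x < n.+1)%N.
Proof.
have [F fF [cF _]] := dim_witness x.
have [M maxM FM] := maxset_exists fF.
by rewrite -cF -(card_maxflag _ maxM) subset_leq_card.
Qed.

Section WythoffPreorder.
Context {n : nat} (V : {set 'I_n.+1}).
Implicit Types U : {set 'I_n.+1}.

(* The set of dimensions {0, ..., n} is ['I_n.+1]; [V] is the fixed set of the
   Wythoff construction. *)
Definition wle U' U : bool :=
  [forall u in U, forall v in V, exists u' in U',
     (u <= u' <= v)%N || (v <= u' <= u)%N].

Definition wsim U U' : bool := wle U U' && wle U' U.

Definition wlt U' U : bool := wle U' U && ~~ wle U U'.

(* [U] is the smallest member, under inclusion, of its [wsim]-class of nonempty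
   sets. *)
Definition essential U : bool :=
  (U != set0) && [forall U' : {set 'I_n.+1},
                    (U' != set0) && wsim U' U ==> (U \subset U')].

Lemma wleP U' U : reflect
  (forall u v, u \in U -> v \in V ->
     exists2 u', u' \in U' & (u <= u' <= v)%N || (v <= u' <= u)%N)
  (wle U' U).
Proof.
apply: (iffP forall_inP) => [h u v uU vV | h u uU].
  by have /forall_inP/(_ v vV)/exists_inP := h u uU.
by apply/forall_inP => v vV; apply/exists_inP; apply: h.
Qed.

Lemma wle_trans : transitive wle.
Proof.
move=> U1 U2 U3 /wleP h21 /wleP h13; apply/wleP => u v uU vV.
have [u1 u1U b1] := h13 _ _ uU vV.
have [u2 u2U b2] := h21 _ _ u1U vV; exists u2 => //.
by case/orP: b1 => /andP[a1 a2]; case/orP: b2 => /andP[a3 a4]; lia.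
Qed.

Lemma essential_isolated U u v0 : essential U -> u \in U -> v0 \in V ->
  exists2 v, v \in V &
    forall u', u' \in U -> (u <= u' <= v)%N || (v <= u' <= u)%N -> u' = u.
Proof.
case/andP=> _ /forallP ess uU v0V.
have [U0|UN0] := eqVneq (U :\ u) set0.
  exists v0 => // u' u'U _; apply/eqP; apply: contraT => u'u.
  by have := in_set0 u'; rewrite -U0 !inE u'u u'U.
have : ~~ wle (U :\ u) U.
  apply/negP => le1; have := ess (U :\ u); rewrite UN0 /wsim le1 /=.
  have -> /= : wle U (U :\ u).
    by apply/wleP => w v /setD1P[_ wU] vV; exists w => //; case: (leqP w v) => h; lia.
  by move/subsetP/(_ u uU); rewrite !inE eqxx.
case/forall_inPn => w wU /forall_inPn[v vV] /exists_inPn h.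
have wu : w = u.
  apply/eqP; apply: contraT => wu; have := h w; rewrite !inE wu wU.
  by move/(_ isT); case: (leqP w v) => ?; lia.
exists v => // u' u'U b; apply/eqP; apply: contraT => u'u.
by have := h u'; rewrite !inE u'u u'U wu b => /(_ isT).
Qed.

Lemma wlt_between U U' U'' u w : essential U'' ->
  wlt U'' U' -> wlt U' U -> u \in U -> w \in U'' ->
  exists2 u', u' \in U' & (u <= u' <= w)%N || (w <= u' <= u)%N.
Proof.
move=> eU'' /andP[/wleP le21 nle] /andP[/wleP le10 _] uU wU.
have [v0 v0V] : exists v0, v0 \in V.
  case/forall_inPn: nle => ? _ /forall_inPn[v0 v0V _]; by exists v0.
have [v vV iso] := essential_isolated eU'' wU v0V.
have [u' u'U b1] := le10 _ _ uU vV.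
have [u'' u''U b2] := le21 _ _ u'U vV.
exists u' => //; case: (boolP ((w <= u'' <= v) || (v <= u'' <= w))%N) => b3.
  have E := congr1 (@nat_of_ord _) (iso _ u''U b3).
  move: b1 b2 b3; rewrite E; lia.
move: b1 b2 b3; lia.
Qed.

End WythoffPreorder.

Section Wythoffian.
Context {n : nat} {disp : Order.disp_t} (K : complexType n disp).
Context (V : {set 'I_n.+1}).

Definition flag_type (F : {set K}) : {set 'I_n.+1} :=
  [set i : 'I_n.+1 | [exists x in F, dim x == i]].

Definition wythoffian : Type :=
  {F : {set K} | flag F && essential V (flag_type F)}.

HB.instance Definition _ := Finite.on wythoffian.

Definition wythoffian_lt (F' F : wythoffian) : bool :=
  wlt V (flag_type (val F')) (flag_type (val F)) && flag (val F :|: val F').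

Lemma wythoffian_lt_irr : irreflexive wythoffian_lt.
Proof. by move=> F; rewrite /wythoffian_lt /wlt andbN. Qed.

Lemma flagUP (F G : {set K}) : flag F -> flag G ->
  reflect {in F & G, forall x y, x >=< y} (flag (F :|: G)).
Proof.
move=> /flagP fF /flagP fG; apply: (iffP (flagP _)) => h x y.
  by move=> xF yG; apply: h; rewrite inE ?xF ?yG ?orbT.
case/setUP=> hx /setUP[] hy; [exact: fF|exact: h| |exact: fG].
by rewrite comparable_sym h.
Qed.

Lemma le_of_dim (x y : K) : x >=< y -> (dim x <= dim y)%N -> x <= y.
Proof.
move=> cxy dxy; case/orP: cxy => //; rewrite le_eqVlt => /orP[/eqP-> //|/lt_dim].
by rewrite ltnNge dxy.
Qed.

Lemma wythoffian_lt_trans : transitive wythoffian_lt.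
Proof.
move=> F1 F2 F0 /andP[w21 f12] /andP[w10 f01].
have [/andP[fF0 e0] /andP[fF1 e1] /andP[fF2 e2]] := And3 (valP F0) (valP F1) (valP F2).
apply/andP; split.
  case/andP: w21 => l21 n12; case/andP: w10 => l10 n01.
  rewrite /wlt (wle_trans l21 l10) /=; apply: contra n01 => l02.
  exact: wle_trans l02 l21.
apply/flagUP => // x y xF yF.
have tP (F : wythoffian) (z : K) : z \in val F -> Ordinal (dim_complex z) \in flag_type (val F).
  by move=> zF; rewrite inE; apply/exists_inP; exists z.
have [i] := wlt_between e2 w21 w10 (tP _ _ xF) (tP _ _ yF).
rewrite inE => /exists_inP[z zF /eqP zi] /=; rewrite -zi.
have cxz : x >=< z by apply: (flagUP _ _ f01).
have czy : z >=< y by apply: (flagUP _ _ f12).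
case/orP=> /andP[d1 d2].
  by rewrite le_comparable // (le_trans (le_of_dim cxz d1) (le_of_dim czy d2)).
rewrite comparable_sym le_comparable //.
rewrite comparable_sym in cxz; rewrite comparable_sym in czy.
exact: le_trans (le_of_dim czy d1) (le_of_dim cxz d2).
Qed.

HB.instance Definition _ := Order.Lt_isPOrder.Build disp wythoffian
  wythoffian_lt_irr wythoffian_lt_trans.

End Wythoffian.

(* The index set {1, ..., d+1} is represented by ['I_d.+1].  The bound on [d]
   is what makes the poset connected. *)
Definition simplex (d : nat) (d_ge2 : (2 <= d)%N) : Type :=
  {X : {set 'I_d.+1} | (X != set0) && (X \proper [set: 'I_d.+1])}.

Section Simplex.
Context {d : nat} (d_ge2 : (2 <= d)%N).
Local Notation S := (simplex d_ge2).
Implicit Types X Y : S.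

HB.instance Definition _ := Finite.on S.

Definition simplex_le X Y : bool := val X \subset val Y.

Lemma simplex_le_refl : reflexive simplex_le.
Proof. by move=> X; apply: subxx. Qed.

Lemma simplex_le_anti : antisymmetric simplex_le.
Proof. by move=> X Y h; apply/val_inj/eqP; rewrite eqEsubset. Qed.

Lemma simplex_le_trans : transitive simplex_le.
Proof. by move=> X Y Z; apply: subset_trans. Qed.

Fact simplex_display : Order.disp_t. Proof. exact: Order.Disp tt tt. Qed.

HB.instance Definition _ := Order.Le_isPOrder.Build simplex_display S
  simplex_le_refl simplex_le_anti simplex_le_trans.

Lemma simplex_card_gt0 X : (0 < #|val X|)%N.
Proof. by rewrite card_gt0; case/andP: (valP X). Qed.

Lemma simplex_card_le X : (#|val X| <= d)%N.
Proof.
by case/andP: (valP X) => _ /proper_card; rewrite cardsT card_ord ltnS.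
Qed.

Lemma simplexP (A : {set 'I_d.+1}) :
  (0 < #|A|)%N -> (#|A| <= d)%N -> {X : S | val X = A}.
Proof.
move=> A0 Ad; have PA : (A != set0) && (A \proper [set: 'I_d.+1]).
  by rewrite -card_gt0 A0 properEcard subsetT cardsT card_ord ltnS.
by exists (Sub A PA); rewrite SubK.
Qed.

Lemma simplex_connected X Y : connect (fun z t : S => z >=< t) X Y.
Proof.
have [x xX] : exists x, x \in val X by apply/card_gt0P/simplex_card_gt0.
have [y yY] : exists y, y \in val Y by apply/card_gt0P/simplex_card_gt0.
have [Zx zx] : {Z : S | val Z = [set x]} by apply: simplexP; rewrite cards1 //; lia.
have [Zy zy] : {Z : S | val Z = [set y]} by apply: simplexP; rewrite cards1 //; lia.
have [Z z] : {Z : S | val Z = [set x; y]}.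
  by apply: simplexP; rewrite cards2 //; lia.
have le (A B : S) : val A \subset val B -> A <= B by [].
apply: (@connect_trans _ _ Zx).
  by apply: connect1; rewrite comparable_sym le_comparable ?le // zx sub1set.
apply: (@connect_trans _ _ Z).
  by apply: connect1; rewrite le_comparable ?le // zx z sub1set !inE eqxx.
apply: (@connect_trans _ _ Zy).
  apply: connect1; rewrite comparable_sym le_comparable ?le // zy z sub1set.
  by rewrite !inE eqxx orbT.
by apply: connect1; rewrite le_comparable ?le // zy sub1set.
Qed.

Lemma flag_simplex_sub (F : {set S}) X Y : flag F -> X \in F -> Y \in F ->
  (#|val X| <= #|val Y|)%N -> val X \subset val Y.
Proof.
move=> /flagP fF XF YF c; have /orP[//|YX] := fF X Y XF YF.
have YX' : val Y \subset val X := YX.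
suff -> : val Y = val X by [].
by apply/eqP; rewrite eqEcard YX' c.
Qed.

Lemma simplex_maxflag (F : {set S}) : maxset flag F -> #|F| = d.-1.+1.
Proof.
move=> maxF; have fF := maxsetp maxF.
pose f X : 'I_d.-1.+1 := inord #|val X|.-1.
have fE X : f X = #|val X|.-1 :> nat.
  rewrite /f inordK //; have := simplex_card_gt0 X; have := simplex_card_le X; lia.
have f_inj : {in F &, injective f}.
  move=> X Y XF YF /(congr1 (@nat_of_ord _)); rewrite !fE => e.
  have c : #|val X| = #|val Y|.
    by rewrite -(prednK (simplex_card_gt0 X)) e prednK ?simplex_card_gt0.
  by apply/val_inj/eqP; rewrite eqEcard c leqnn andbT (flag_simplex_sub fF) ?c.
rewrite -(card_in_imset f_inj); suff -> : f @: F = setT by rewrite cardsT card_ord.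
apply/setP => i; rewrite inE; apply: contraT => iN.
have nF X : X \in F -> #|val X| != i.+1.
  move=> XF; apply: contra iN => /eqP c; apply/imsetP; exists X => //.
  by apply/val_inj; rewrite /= fE c.
have id : (i < d)%N by have := ltn_ord i; lia.
(* the largest member of F below size i.+1, or the empty set *)
pose G := set0 |: [set val X | X in F & (#|val X| <= i)%N].
have G0 : set0 \in G by rewrite inE in_set1 eqxx.
case: (@arg_maxnP _ set0 (mem G) (fun A => #|A|) G0) => A AG maxA.
have cA : (#|A| <= i)%N.
  case/setU1P: AG => [->|/imsetP[X]]; first by rewrite cards0.
  by rewrite inE => /andP[_ ?] ->.
have AF X : X \in F -> (#|val X| <= i)%N -> val X \subset A.
  move=> XF cX; have /maxA/= cXA : val X \in G.
    by rewrite inE; apply/orP; right; apply/imsetP; exists X; rewrite ?inE ?XF.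
  case/setU1P: AG => [A0|/imsetP[Y]].
    by move: cXA; rewrite A0 cards0 leqn0 cards_eq0 => /eqP->.
  rewrite inE => /andP[YF cY] e; move: cXA; rewrite e; exact: (flag_simplex_sub fF).
have FA X : X \in F -> (i < #|val X|)%N -> A \subset val X.
  move=> XF cX; case/setU1P: AG => [->|/imsetP[Y]]; first exact: sub0set.
  rewrite inE => /andP[YF cY] ->; apply: (flag_simplex_sub fF) => //; exact: leq_trans cY (ltnW cX).
(* the smallest member of F above size i.+1, or the full set *)
pose H := setT |: [set val X | X in F & (i < #|val X|)%N].
have H0 : setT \in H by rewrite inE in_set1 eqxx.
case: (@arg_minnP _ setT (mem H) (fun A => #|A|) H0) => B BH minB.
have cB : (i.+1 < #|B|)%N.
  case/setU1P: BH => [->|/imsetP[X]]; first by rewrite cardsT card_ord !ltnS.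
  rewrite inE => /andP[XF cX] ->; by rewrite ltn_neqAle eq_sym nF.
have FB X : X \in F -> (i < #|val X|)%N -> B \subset val X.
  move=> XF cX; have /minB/= cXB : val X \in H.
    by rewrite inE; apply/orP; right; apply/imsetP; exists X; rewrite ?inE ?XF.
  case/setU1P: BH => [B0|/imsetP[Y]].
    by move: cXB; rewrite B0 cardsT card_ord leqNgt ltnS simplex_card_le.
  rewrite inE => /andP[YF cY] e; move: cXB; rewrite e; exact: (flag_simplex_sub fF).
have AB : A \subset B.
  by case/setU1P: BH => [->|/imsetP[Y]]; [exact: subsetT|rewrite inE => /andP[YF cY] ->; exact: FA].
have [b bB bA] : exists2 b, b \in B & b \notin A.
  apply/subsetPn/negP => /subset_leq_card; lia.
have [Z zE] : {Z : S | val Z = b |: A}.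
  apply: simplexP; rewrite cardsU1 bA /= ?add1n //; exact: leq_ltn_trans cA id.
have ZN : Z \notin F.
  have cZ : #|val Z| = #|A|.+1 by rewrite zE cardsU1 bA.
  apply/negP => ZF; have /negP := nF Z ZF; apply; rewrite cZ eqSS eqn_leq cA /=.
  rewrite leqNgt; apply/negP => Ai.
  have cZi : (#|val Z| <= i)%N by rewrite cZ.
  by have /subsetP/(_ b) := AF Z ZF cZi; rewrite zE setU11 (negPf bA) => /(_ isT).
have fZ : flag (Z |: F).
  have key X : X \in F -> Z >=< X.
    move=> XF; case: (leqP #|val X| i) => cX.
      rewrite comparable_sym le_comparable // /Order.le /= /simplex_le zE.
      exact: subset_trans (AF X XF cX) (subsetUr _ _).
    rewrite le_comparable // /Order.le /= /simplex_le zE.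
    rewrite subUset sub1set (FA X XF cX) andbT; exact: (subsetP (FB X XF cX)).
  apply/flagP => X Y /setU1P[->|XF] /setU1P[->|YF] //; [exact: comparablexx|exact: key| |].
    by rewrite comparable_sym key.
  exact: (flagP F fF).
have := maxsetsup maxF fZ (subsetUr _ _) => E.
by rewrite -E setU11 in ZN.
Qed.

HB.instance Definition _ := isComplex.Build d.-1 simplex_display S
  simplex_connected simplex_maxflag.

End Simplex.

Record graph := Graph {
  vertex :> finType;
  adj : rel vertex;
  adj_sym : symmetric adj;
  adj_irr : irreflexive adj
}.

Definition graph_iso (G H : graph) : Prop :=
  exists2 f : G -> H, bijective f & forall x y, adj (f x) (f y) = adj x y.

Section Skeleton.
Context {disp : Order.disp_t} (T : finPOrderType disp).

(* Faces of dimension 0 are vertices, faces of dimension 1 are edges; parallel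
   edges are identified. *)
Definition skeleton_vertex : finType := {x : T | dim x == 0%N}.

Definition skeleton_adj (x y : skeleton_vertex) : bool :=
  (x != y) && [exists e : T, (dim e == 1%N) && (val x < e) && (val y < e)].

Lemma skeleton_adj_sym : symmetric skeleton_adj.
Proof.
move=> x y; rewrite /skeleton_adj eq_sym; congr (_ && _).
by apply: eq_existsb => e; rewrite andbAC.
Qed.

Lemma skeleton_adj_irr : irreflexive skeleton_adj.
Proof. by move=> x; rewrite /skeleton_adj eqxx. Qed.

Definition skeleton : graph := Graph skeleton_adj_sym skeleton_adj_irr.

End Skeleton.

Section Johnson.
Context (m n : nat).

Definition johnson_vertex : finType :=
  {x : {ffun 'I_m -> bool} | \sum_(i < m) x i == n}.

Definition johnson_adj (x y : johnson_vertex) : bool :=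
  #|[set i | val x i != val y i]| == 2.

Lemma johnson_adj_sym : symmetric johnson_adj.
Proof.
by move=> x y; congr (#|pred_of_set _| == 2); apply/setP => i; rewrite !inE eq_sym.
Qed.

Lemma johnson_adj_irr : irreflexive johnson_adj.
Proof.
move=> x; rewrite /johnson_adj (_ : [set _ | _] = set0) ?cards0 //.
by apply/setP => i; rewrite !inE eqxx.
Qed.

Definition johnson : graph := Graph johnson_adj_sym johnson_adj_irr.

End Johnson.

(* Main.v *)
Require Import Defs.
From mathcomp Require Import all_boot all_order.
From mathcomp Require Import zify.

(** For a singleton [[set k]] the preorder on types only records how close a type
    comes to [k] from below and from above.  The class of [[set k]] is therefore
    the bottom one, and a type is essential exactly when none of its dimensions
    lies between another one and [k] ([essential1P]).  In any n-complex this
    determines the faces of low dimension of the Wythoffian: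
    - the vertices are the flags [[set x]] with [dim x = k], since every flag is
      comparable with some face of dimension [k] ([wyth_dim0P]);
    - the edges are the flags whose type consists of those of [k - 1] and [k + 1]
      that lie in {0, ..., n} ([wyth_edge]).  If such a neighbour [j] of [k] were
      missing from the type of an edge, inserting a face of dimension [j] in place
      of the part of the edge on that side of [k] would give a flag strictly
      between a vertex and the edge.

    In the simplex the vertices are thus the subsets of size [k + 1], and two of
    them, x and y, lie below a common edge exactly when there are a set of size
    [k] below both and a set of size [k + 2] above both, where for the extreme
    values of [k] the empty or the full set takes the place of an absent face.
    For distinct x and y of equal size this says that their intersection has size
    [k], that is, that the symmetric difference has size 2 ([common_edge_card],
    [card_symdiff]), which is adjacency in the Johnson graph. *)

Set Implicit Arguments.
Unset Strict Implicit.
Unset Printing Implicit Defensive.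

Import Order.TTheory.
Local Open Scope order_scope.

(** * Dimensions 0 and 1 in a finite poset *)

Section Dimension.
Context {disp : Order.disp_t} {T : finPOrderType disp}.
Implicit Types x y : T.

(** Removing [x] from a largest flag of elements up to [x] leaves a flag whose greatest
    element is the required [y]; so the height never skips a value. *)
Lemma dim_pred x : (0 < dim x)%N -> exists2 y, y < x & dim x = (dim y).+1.
Proof.
move=> x_gt0; have [F fF [cF leF]] := dim_witness x.
have fF' : flag (F :\ x).
  by apply/flagP => y z /setD1P[_ yF] /setD1P[_ zF]; apply: (flagP F fF).
have cF' : (dim x <= #|F :\ x|)%N by have := cardsD1 x F; rewrite cF; lia.
have [y0 y0F'] : exists y0, y0 \in F :\ x by apply/card_gt0P; lia.
have [y yF' max_y] := @arg_maxnP _ y0 (mem (F :\ x)) dim y0F'.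
have yx : y < x by case/setD1P: (yF') => yNx yF; rewrite lt_neqAle yNx leF.
exists y => //; apply/eqP; rewrite eqn_leq lt_dim // andbT.
apply: leq_trans cF' (leq_dim fF' _) => z zF'.
case/orP: (flagP _ fF' _ _ zF' yF') => //; rewrite le_eqVlt => /orP[/eqP-> //|].
by move/lt_dim; have /= := max_y z zF'; lia.
Qed.

Lemma dim_eq0P x : reflect (forall y, ~~ (y < x)) (dim x == 0%N).
Proof.
apply: (iffP eqP) => [x0 y | min_x].
  by apply/negP => /lt_dim; rewrite x0.
apply/eqP; rewrite -leqn0 leqNgt; apply/negP => /dim_pred[y yx _].
by have := min_x y; rewrite yx.
Qed.

Lemma dim_eq1P x :
  reflect ((exists y, y < x) /\ (forall y, y < x -> dim y = 0%N)) (dim x == 1%N).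
Proof.
apply: (iffP eqP) => [x1 | [[y yx] below0]].
  split=> [|y /lt_dim]; last by lia.
  by have [|y yx _] := @dim_pred x; [rewrite x1|exists y].
have [|z zx ->] := @dim_pred x; last by rewrite below0.
exact: leq_ltn_trans (leq0n _) (lt_dim yx).
Qed.

End Dimension.

(** * Flags of an n-complex and their types *)

Section ComplexFlags.
Context {n : nat} {disp : Order.disp_t} (K : complexType n disp).
Implicit Types (F M : {set K}) (x y : K).

Lemma flag_dim_inj F : flag F -> {in F &, injective (@dim disp K)}.
Proof.
move=> fF x y xF yF e; apply: le_anti.
by rewrite !le_of_dim ?(flagP F fF) ?e.
Qed.

(** Pigeonhole: the dimension is injective on a flag, and a maximal flag has as
    many members as there are dimensions. *)
Lemma maxflag_dim M (i : 'I_n.+1) :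
  maxset flag M -> exists2 x, x \in M & dim x = i.
Proof.
move=> maxM; pose f x := Ordinal (dim_complex x).
have f_inj : {in M &, injective f}.
  move=> x y xM yM [e]; exact: flag_dim_inj (maxsetp maxM) _ _ xM yM e.
have : i \in f @: M.
  suff -> : f @: M = setT by rewrite inE.
  apply/eqP; rewrite eqEcard subsetT cardsT card_ord /=.
  by rewrite (card_in_imset f_inj) (card_maxflag _ maxM).
by case/imsetP => x xM ->; exists x.
Qed.

(** This is the only source of new faces for the constructions below: a face of
    any prescribed dimension can be inserted into, or already belongs to, a given
    flag. *)
Lemma flag_refine F (i : 'I_n.+1) : flag F ->
  exists2 x, dim x = i & {in F, forall y, x >=< y}.
Proof.
move=> /maxset_exists[M maxM /subsetP FM].
have [x xM dx] := maxflag_dim i maxM; exists x => // y /FM yM.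
exact: (flagP M (maxsetp maxM)).
Qed.

Lemma flag_typeP F (i : 'I_n.+1) :
  reflect (exists2 x, x \in F & dim x = i) (i \in flag_type F).
Proof.
rewrite inE; apply: (iffP exists_inP) => [[x xF /eqP]|[x xF /eqP]]; by exists x.
Qed.

Lemma flag_type1 x (i : 'I_n.+1) : dim x = i -> flag_type [set x] = [set i].
Proof.
move=> dx; apply/setP => j; rewrite in_set1; apply/flag_typeP/eqP.
  by case=> y /set1P->; rewrite dx => /ord_inj.
by move->; exists x; rewrite ?set11.
Qed.

Lemma flag_type_eq1 F (i : 'I_n.+1) : flag F -> flag_type F = [set i] ->
  exists2 x, dim x = i & F = [set x].
Proof.
move=> fF tF; have /flag_typeP[x xF dx] : i \in flag_type F by rewrite tF set11.
exists x => //; apply/setP => y; rewrite in_set1; apply/idP/eqP => [yF | -> //].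
apply: (flag_dim_inj fF) => //; rewrite dx.
suff /set1P<- : Ordinal (dim_complex y) \in [set i] by [].
by rewrite -tF; apply/flag_typeP; exists y.
Qed.

Lemma flag1 x : flag [set x].
Proof. by apply/flagP => y z /set1P-> /set1P->; apply: comparablexx. Qed.

End ComplexFlags.

(** * The preorder on types for a single ringed dimension *)

Section SingletonPreorder.
Context {n : nat} (k : 'I_n.+1).
Implicit Types U : {set 'I_n.+1}.

(** The betweenness condition of [wle] with [v] fixed to be [k]. *)
Definition toward (u u' : 'I_n.+1) : bool :=
  ((u <= u' <= k) || (k <= u' <= u))%N.

Lemma wle1P U' U : reflect
  (forall u, u \in U -> exists2 u', u' \in U' & toward u u') (wle [set k] U' U).
Proof.
apply: (iffP (wleP _ _ _)) => [h u uU | h u v uU /set1P->]; last exact: h.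
by apply: h; rewrite ?set11.
Qed.

(** Only the dimension closest to [k] on each side matters for the class of a
    type, so minimality means that no member screens another one from [k].
    Conversely, if [U'] is equivalent to such a [U], going from [u] in [U] to [U']
    and back to [U] moves towards [k] and returns to [u], whence [u] is in [U']. *)
Lemma essential1P U : reflect
  (U != set0 /\ forall u u', u \in U -> u' \in U -> toward u u' -> u' = u)
  (essential [set k] U).
Proof.
apply: (iffP idP) => [eU | [UN0 iso]].
  split=> [|u u' uU u'U]; first by case/andP: eU.
  have [v /set1P-> iso] := essential_isolated eU uU (set11 k).
  exact: iso.
rewrite /essential UN0 /=; apply/forall_inP => U' /and3P[_ /wle1P le1 /wle1P le2].
apply/subsetP => u uU.
have [u' u'U' b1] := le1 u uU; have [u'' u''U b2] := le2 u' u'U'.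
have E : u'' = u.
  by apply: (iso u u'') => //; move: b1 b2; rewrite /toward; lia.
suff -> : u = u' by [].
by apply: ord_inj; move: b1 b2; rewrite E /toward; lia.
Qed.

Lemma wle_bottom U : wle [set k] [set k] U.
Proof. by apply/wle1P => u _; exists k; rewrite ?set11 // /toward; lia. Qed.

Lemma essential_center : essential [set k] [set k].
Proof.
apply/essential1P; split=> [|u u' /set1P-> /set1P-> //].
by apply/set0Pn; exists k; apply: set11.
Qed.

Lemma essential_eq1 U : essential [set k] U -> k \in U -> U = [set k].
Proof.
move=> /essential1P[_ iso] kU; apply/setP => u; rewrite in_set1.
by apply/idP/eqP => [uU|-> //]; rewrite -(iso u k) // /toward; lia.
Qed.

Lemma wlt_bottom U : wlt [set k] [set k] U = (k \notin U).
Proof.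
rewrite /wlt wle_bottom /=; congr (~~ _); apply/wle1P/idP => [/(_ k (set11 k))|kU u].
  by case=> u uU b; rewrite -(_ : u = k) //; apply: ord_inj; move: b; rewrite /toward; lia.
by move=> /set1P->; exists k; rewrite // /toward; lia.
Qed.

Lemma neq_center U u : k \notin U -> u \in U -> u <> k :> nat.
Proof. by move=> kU uU /ord_inj e; rewrite -e uU in kU. Qed.

Definition neighbours : {set 'I_n.+1} :=
  [set i : 'I_n.+1 | (i.+1 == k) || (i == k.+1 :> nat)].

Lemma neighboursP (i : 'I_n.+1) :
  reflect (i.+1 = k \/ i = k.+1 :> nat) (i \in neighbours).
Proof. by rewrite inE; apply: (iffP orP) => -[/eqP|/eqP]; auto. Qed.

Lemma neighbours_center : k \notin neighbours.
Proof. by apply/neighboursP; lia. Qed.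

Lemma essential_neighbours : neighbours != set0 -> essential [set k] neighbours.
Proof.
move=> N0; apply/essential1P; split=> // u u' /neighboursP hu /neighboursP hu'.
by rewrite /toward => b; apply: ord_inj; lia.
Qed.

Lemma neighbour_toward (u : 'I_n.+1) : u <> k :> nat ->
  exists2 v, v \in neighbours & toward u v.
Proof.
move=> uk; have [lt|gt] : (u < k \/ k < u)%N by lia.
  have h : (k.-1 < n.+1)%N by have := ltn_ord k; lia.
  by exists (Ordinal h); [apply/neighboursP; left|rewrite /toward]; rewrite /=; lia.
have h : (k.+1 < n.+1)%N by have := ltn_ord u; lia.
by exists (Ordinal h); [apply/neighboursP; right|rewrite /toward]; rewrite /=; lia.
Qed.

(** A dimension other than [k] has a neighbour of [k] between itself and [k], so a
    type avoiding [k] cannot be strictly below the set of neighbours. *)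
Lemma wlt_neighbours U : wlt [set k] U neighbours -> k \in U.
Proof.
case/andP=> _ /negP nle; apply: contraT => kU; case: nle; apply/wle1P => u uU.
exact: neighbour_toward (neq_center kU uU).
Qed.

End SingletonPreorder.

(** * Vertices and edges of the Wythoffian *)

Section SingletonWythoffian.
Context {n : nat} {disp : Order.disp_t} (K : complexType n disp) (k : 'I_n.+1).
Local Notation W := (wythoffian K [set k]).
Implicit Types F G : W.

Lemma wyth_flag F : flag (val F).
Proof. by case/andP: (valP F). Qed.

Lemma wyth_essential F : essential [set k] (flag_type (val F)).
Proof. by case/andP: (valP F). Qed.

Lemma wyth_exists (A : {set K}) :
  flag A -> essential [set k] (flag_type A) -> {F : W | val F = A}.
Proof.
by move=> fA eA; have PA := introT andP (conj fA eA); exists (Sub A PA); rewrite SubK.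
Qed.

Lemma wyth_vertex (x : K) : dim x = k -> {F : W | val F = [set x]}.
Proof.
move=> dx; apply: wyth_exists; first exact: flag1.
by rewrite (flag_type1 dx) essential_center.
Qed.

Lemma wyth_ltP F' F : reflect
  (wlt [set k] (flag_type (val F')) (flag_type (val F))
     /\ {in val F & val F', forall x y, x >=< y}) (F' < F).
Proof.
apply: (iffP andP) => -[w h]; split=> //.
  exact: (flagUP (wyth_flag F) (wyth_flag F') h).
by apply/(flagUP (wyth_flag F) (wyth_flag F')).
Qed.

Lemma vertex_ltP F (X : W) (x : K) : dim x = k -> val X = [set x] ->
  reflect (k \notin flag_type (val F) /\ {in val F, forall y, x >=< y}) (X < F).
Proof.
move=> dx vX; apply: (iffP (wyth_ltP _ _)); rewrite vX (flag_type1 dx) wlt_bottom.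
  by case=> kF h; split=> // y yF; rewrite comparable_sym h ?set11.
by case=> kF h; split=> // y z yF /set1P->; rewrite comparable_sym h.
Qed.

Lemma wyth_dim0 F : (dim F == 0%N) = (flag_type (val F) == [set k]).
Proof.
apply/dim_eq0P/eqP => [min_F | tF G].
  apply: essential_eq1 (wyth_essential F) _; apply: contraT => kF.
  have [x dx cx] := flag_refine k (wyth_flag F).
  have [X vX] := wyth_vertex dx.
  by case/negP: (min_F X); apply/(vertex_ltP _ dx vX).
by apply/negP => /wyth_ltP[/andP[_]]; rewrite tF wle_bottom.
Qed.

Lemma wyth_dim0P F :
  reflect (exists2 x, dim x = k & val F = [set x]) (dim F == 0%N).
Proof.
rewrite wyth_dim0; apply: (iffP eqP) => [|[x dx ->]]; last exact: flag_type1.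
exact: flag_type_eq1 (wyth_flag F).
Qed.

(** If [j] were missing, a face of dimension [j] comparable with all of [F] could
    replace the members of [F] on the same side of [k] as [j].  The resulting flag
    has a smaller type than [F] yet avoids the dimension [k], so it lies below [F]
    without being a vertex. *)
Lemma wyth_below_edge F G :
  (dim F == 1%N) -> G < F -> forall j, j \in neighbours k -> j \in flag_type (val F).
Proof.
move=> /dim_eq1P[_ below0] GF j /neighboursP jk.
have /eqP/wyth_dim0P[x dx vG] := below0 _ GF.
have /(vertex_ltP _ dx vG)[kF cx] := GF.
apply: contraT => jF.
have [w dw cw] := flag_refine j (wyth_flag F).
(* The inequality selects the members of F on the other side of k from j. *)
pose A := w |: [set y in val F | (dim y < k)%N != (j < k)%N].
have AP y : y \in A -> y = w \/ y \in val F /\ (dim y < k)%N != (j < k)%N.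
  by rewrite !inE => /orP[/eqP->|/andP[]]; auto.
have wA : w \in A by rewrite setU11.
have tA i : i \in flag_type A -> i = j \/ i \in flag_type (val F) /\ (i < k)%N != (j < k)%N.
  case/flag_typeP => y /AP[->|[yF h]] di; first by left; apply: ord_inj; rewrite -di.
  by right; rewrite -di; split=> //; apply/flag_typeP; exists y.
have jA : j \in flag_type A by apply/flag_typeP; exists w.
have iso := proj2 (essential1P _ _ (wyth_essential F)).
have kN i := @neq_center _ _ _ i kF.
have fA : flag A.
  apply/flagP => y z /AP[->|[yF _]] /AP[->|[zF _]]; first exact: comparablexx.
  - exact: cw.
  - by rewrite comparable_sym cw.
  - exact: (flagP _ (wyth_flag F)).
have eA : essential [set k] (flag_type A).
  apply/essential1P; split=> [|u u' /tA hu /tA hu']; first by apply/set0Pn; exists j.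
  case: hu => [-> | [uF hu]]; case: hu' => [-> // | [u'F hu']]; rewrite /toward => b.
  - by have := kN _ u'F; lia.
  - by have := kN _ uF; lia.
  - exact: iso.
have [Z vZ] := wyth_exists fA eA.
have ZF : Z < F.
  apply/wyth_ltP; split; last first.
    move=> y z yF; rewrite vZ => /AP[->|[zF _]]; first by rewrite comparable_sym cw.
    exact: (flagP _ (wyth_flag F)).
  rewrite vZ; apply/andP; split.
    apply/wle1P => u uF; have := kN u uF => uk.
    case: (boolP ((u < k)%N == (j < k)%N)) => h.
      by exists j => //; rewrite /toward; lia.
    exists u; last by rewrite /toward; lia.
    have /flag_typeP[y yF dy] := uF; apply/flag_typeP; exists y => //.
    by rewrite !inE yF dy h orbT.
  apply/negP => /wle1P/(_ j jA)[u uF b]; have uk := kN u uF.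
  by case/negP: jF; rewrite -(_ : u = j) //; apply: ord_inj; move: b; rewrite /toward; lia.
have := below0 _ ZF => /eqP; rewrite wyth_dim0 vZ => /eqP e.
by move: jA jk; rewrite e in_set1 => /eqP->; lia.
Qed.

Lemma wyth_edge F : (dim F == 1%N) = (flag_type (val F) == neighbours k).
Proof.
apply/idP/eqP => [F1 | tF].
  have /dim_eq1P[[G GF] below0] := F1.
  have nF := wyth_below_edge F1 GF.
  have /eqP/wyth_dim0P[x dx vG] := below0 _ GF.
  have /(vertex_ltP _ dx vG)[kF _] := GF.
  have iso := proj2 (essential1P _ _ (wyth_essential F)).
  apply/setP => u; apply/idP/idP => [uF | ]; last exact: nF.
  have [v vN uv] := neighbour_toward (neq_center kF uF).
  by rewrite -(iso u v) // nF.
apply/dim_eq1P; split.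
  have [x dx cx] := flag_refine k (wyth_flag F).
  have [X vX] := wyth_vertex dx; exists X; apply/(vertex_ltP _ dx vX).
  by rewrite tF neighbours_center.
move=> G /wyth_ltP[]; rewrite tF => /wlt_neighbours kG _; apply/eqP.
by rewrite wyth_dim0; apply/eqP; apply: essential_eq1 (wyth_essential G) kG.
Qed.

End SingletonWythoffian.

(** * Dimension in the simplex *)

Section SimplexDim.
Context {d : nat} (d_ge2 : (2 <= d)%N).
Local Notation S := (simplex d_ge2).
Implicit Types X Y : S.

Lemma simplex_ltE X Y : (X < Y) = (val X \proper val Y).
Proof. by rewrite lt_neqAle properEneq. Qed.

(** Cardinality is injective on a flag, which bounds the height from above; the
    lower bound comes from deleting the points of [X] one at a time. *)
Lemma simplex_dim X : (dim X).+1 = #|val X|.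
Proof.
apply/eqP; rewrite eqn_leq; apply/andP; split.
  have [F fF [<- leF]] := dim_witness X.
  pose f Y : 'I_#|val X|.+1 := inord #|val Y|.
  have fE Y : Y \in F -> f Y = #|val Y| :> nat.
    by move=> YF; rewrite inordK // ltnS; apply/subset_leq_card/(leF Y YF).
  have f_inj : {in F &, injective f}.
    move=> Y Z YF ZF /(congr1 (@nat_of_ord _)); rewrite !fE // => e.
    by apply/val_inj/eqP; rewrite eqEcard e leqnn andbT (flag_simplex_sub fF) ?e.
  rewrite -(card_in_imset f_inj).
  have /subset_leq_card : f @: F \subset [set~ ord0].
    apply/subsetP => _ /imsetP[Y YF ->]; rewrite !inE -val_eqE /= fE //.
    by rewrite -lt0n simplex_card_gt0.
  by rewrite cardsC1 card_ord.
move cX: #|val X| => m; elim: m X cX => // -[|m] IHm X cX //; rewrite ltnS.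
have [x xX] : exists x, x \in val X by apply/card_gt0P/simplex_card_gt0.
have cX' := cardsD1 x (val X); rewrite xX cX in cX'.
have cXd := simplex_card_le X.
have [Y vY] : {Y : S | val Y = val X :\ x} by apply: simplexP; lia.
have YX : Y < X by rewrite simplex_ltE vY properD1.
apply: leq_trans (lt_dim YX); apply: IHm; rewrite vY; lia.
Qed.

Lemma simplex_comparable X Y : (#|val X| <= #|val Y|)%N ->
  (X >=< Y) = (val X \subset val Y).
Proof.
move=> cXY; apply/orP/idP => [[//|YX] | XY]; last by left.
have YX' : val Y \subset val X := YX.
by have /eqP-> : val Y == val X by rewrite eqEcard YX' cXY.
Qed.

End SimplexDim.

(** * Common edges of two vertices and symmetric differences *)

Lemma card_setD_eq1 (T : finType) (A B : {set T}) m : #|A| = m.+1 ->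
  (#|A :\: B| == 1%N) = (#|A :&: B| == m).
Proof. by have := cardsID B A; lia. Qed.

Lemma card_setU_setI (T : finType) (A B : {set T}) m :
  #|A| = m.+1 -> #|B| = m.+1 -> #|A :&: B| = m -> #|A :|: B| = m.+2.
Proof. by have := cardsUI A B; lia. Qed.

Lemma card_symdiff (T : finType) (A B : {set T}) : #|A| = #|B| ->
  #|[set i | (i \in A) != (i \in B)]| = (#|A :\: B|).*2.
Proof.
move=> cAB; have -> : [set i | (i \in A) != (i \in B)] = (A :\: B) :|: (B :\: A).
  by apply/setP => i; rewrite !inE; case: (i \in A); case: (i \in B).
have -> : (#|A :\: B|).*2 = (#|A :\: B| + #|B :\: A|)%N.
  by have := cardsID B A; have := cardsID A B; rewrite setIC; lia.
apply/eqP; rewrite (leq_card_setU _ _).2 disjoints_subset.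
by apply/subsetP => i; rewrite !inE => /andP[/negPf-> ->].
Qed.

Section SimplexWythoffian.
Context {d : nat} (d_ge2 : (2 <= d)%N) (k : 'I_d.-1.+1).
Local Notation S := (simplex d_ge2).
Local Notation W := (wythoffian S [set k]).

(** Both directions use that an edge has a member of every dimension next to [k].
    Of these, the one below, when [k] is positive, already forces [x] and [y] to
    meet in [k] points.  Conversely the edge consists of the intersection and the
    union of [x] and [y], as far as these are faces. *)
Lemma common_edge_card (X Y : W) (x y : S) :
    dim x = k -> dim y = k -> val X = [set x] -> val Y = [set y] ->
  (X != Y) && [exists E : W, (dim E == 1%N) && (X < E) && (Y < E)]
    = (#|val x :\: val y| == 1%N).
Proof.
move=> dx dy vX vY; have cx : #|val x| = k.+1 by rewrite -simplex_dim dx.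
have cy : #|val y| = k.+1 by rewrite -simplex_dim dy.
rewrite (card_setD_eq1 _ cx).
apply/andP/idP => [[XY /existsP[E /andP[/andP[E1 XE] YE]]] | /eqP cI].
  have cI_le : (#|val x :&: val y| <= k)%N.
    rewrite -ltnS -cx proper_card // properEneq subsetIl andbT.
    apply: contra XY => /eqP/setIidPl sxy; apply/eqP/val_inj; rewrite vX vY.
    by congr [set _]; apply/val_inj/eqP; rewrite eqEcard sxy cx cy /=.
  rewrite eqn_leq cI_le /=; case: (posnP k) => [-> //|k_gt0].
  (* The member [a] of the edge of dimension [k - 1] is a common part of size [k]. *)
  have h : (k.-1 < d.-1.+1)%N by have := ltn_ord k; lia.
  have := wyth_edge E; rewrite E1 => /esym/eqP tE.
  have : Ordinal h \in flag_type (val E) by rewrite tE inE /= prednK ?eqxx.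
  case/flag_typeP=> a aE /= da.
  have ca : #|val a| = k by rewrite -simplex_dim da prednK.
  have /(vertex_ltP _ dx vX)[_ /(_ _ aE) cxa] := XE.
  have /(vertex_ltP _ dy vY)[_ /(_ _ aE) cya] := YE.
  have sub : val a \subset val x :&: val y.
    rewrite comparable_sym in cxa; rewrite comparable_sym in cya.
    rewrite subsetI; move: cxa cya.
    by rewrite !simplex_comparable ?ca ?cx ?cy => [-> ->| |]; lia.
  by rewrite -ca subset_leq_card.
split.
  apply/negP => /eqP/(congr1 val); rewrite vX vY => /set1_inj e.
  by move: cI; rewrite e setIid cy; lia.
have cU := card_setU_setI cx cy cI.
pose A := [set z : S | (val z == val x :&: val y) || (val z == val x :|: val y)].
have AP (z : S) : z \in A -> val z = val x :&: val y \/ val z = val x :|: val y.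
  by rewrite inE => /orP[/eqP|/eqP]; auto.
have cmp (z t : S) : val z \subset val t -> z >=< t by move=> h; apply/orP; left.
have fA : flag A.
  have IU : val x :&: val y \subset val x :|: val y.
    exact: subset_trans (subsetIl _ _) (subsetUl _ _).
  apply/flagP => z t /AP[] hz /AP[] ht; last 1 first.
  - by apply: cmp; rewrite hz ht.
  - by apply: cmp; rewrite hz ht.
  - by apply: cmp; rewrite hz ht.
  - by rewrite comparable_sym cmp // hz ht.
have tA : flag_type A = neighbours k.
  apply/setP => i; apply/flag_typeP/neighboursP.
    by case=> z /AP[] hz dz; move: (simplex_dim z); rewrite hz dz ?cI ?cU; lia.
  have id := ltn_ord i.
  case=> ik.
    have [z zE] : {z : S | val z = val x :&: val y} by apply: simplexP; rewrite cI; lia.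
    exists z; first by rewrite inE zE eqxx.
    by apply/eqP; rewrite -eqSS simplex_dim zE cI ik.
  have [z zE] : {z : S | val z = val x :|: val y} by apply: simplexP; rewrite cU; lia.
  exists z; first by rewrite inE zE eqxx orbT.
  by apply/eqP; rewrite -eqSS simplex_dim zE cU ik.
(* Since [d >= 2] there are at least two dimensions, so [k] has a neighbour. *)
have N0 : neighbours k != set0.
  have kd := ltn_ord k; apply/set0Pn.
  case: (posnP k) => [k0|k_gt0].
    have h : (1 < d.-1.+1)%N by lia.
    by exists (Ordinal h); apply/neighboursP; right; rewrite /= k0.
  have h : (k.-1 < d.-1.+1)%N by lia.
  by exists (Ordinal h); apply/neighboursP; left; rewrite /= prednK.
have [||E vE] := @wyth_exists _ _ S k A => //.
  by rewrite tA essential_neighbours.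
have kE : k \notin flag_type (val E) by rewrite vE tA neighbours_center.
apply/existsP; exists E; rewrite wyth_edge vE tA eqxx /=.
apply/andP; split.
  apply/(vertex_ltP _ dx vX); split=> // z; rewrite vE => /AP[] hz.
    by rewrite comparable_sym cmp // hz subsetIl.
  by rewrite cmp // hz subsetUl.
apply/(vertex_ltP _ dy vY); split=> // z; rewrite vE => /AP[] hz.
  by rewrite comparable_sym cmp // hz subsetIr.
by rewrite cmp // hz subsetUr.
Qed.

End SimplexWythoffian.

(** * The isomorphism *)

Lemma johnson_vertex_card m n (J : johnson_vertex m n) : #|[set i | val J i]| = n.
Proof.
rewrite -[RHS](eqP (valP J)) -sum1_card big_mkcond.
by apply: eq_bigr => i _; rewrite inE; case: (val J i).
Qed.

Theorem proposition2 (d : nat) (d_ge2 : (2 <= d)%N) (k : 'I_d.-1.+1) :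
  graph_iso (skeleton (wythoffian (simplex d_ge2) [set k])) (johnson d.+1 k.+1).
Proof.
set G := skeleton _; set H := johnson _ _.
have vertexP (X : G) : {x : simplex d_ge2 | dim x = k & val (val X) = [set x]}.
  have /wyth_dim0P h := valP X; case: (pickP (fun x => (dim x == k) && (val (val X) == [set x]))).
    by move=> x /andP[/eqP dx /eqP vX]; exists x.
  by move=> h'; exfalso; case: h => x dx vX; have := h' x; rewrite dx vX !eqxx.
pose face (X : G) := s2val (vertexP X).
have dim_face X : dim (face X) = k := s2valP (vertexP X).
have val_face X : val (val X) = [set face X] := s2valP' (vertexP X).
have card_face X : #|val (face X)| = k.+1 by rewrite -simplex_dim dim_face.
have sum_face (X : G) : \sum_(i < d.+1) [ffun i => i \in val (face X)] i == k.+1.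
  rewrite -(card_face X) -sum1_card [X in _ == X]big_mkcond /=.
  by apply/eqP/eq_bigr => i _; rewrite ffunE; case: ifP.
pose f (X : G) : H := Sub [ffun i => i \in val (face X)] (sum_face X).
exists f; last first.
  move=> X Y; rewrite /= /johnson_adj /skeleton_adj -val_eqE.
  rewrite (common_edge_card (dim_face X) (dim_face Y) (val_face X) (val_face Y)).
  rewrite !SubK (_ : [set _ | _] =
    [set i | (i \in val (face X)) != (i \in val (face Y))]); last first.
    by apply/setP => i; rewrite !inE !ffunE.
  by rewrite card_symdiff ?card_face // -[2]/(1.*2) (inj_eq double_inj).
have f_inj : injective f.
  move=> X Y /(congr1 val); rewrite !SubK => /ffunP e.
  apply/val_inj/val_inj; rewrite !val_face; congr [set _]; apply/val_inj/setP => i.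
  by have := e i; rewrite !ffunE.
(* An indicator vector of weight [k + 1] is that of a nonempty proper subset, as
   [k < d]; this subset is the face of the corresponding vertex. *)
have f_surj (J : H) : {X : G | f X = J}.
  have cJ := johnson_vertex_card J.
  have [x vx] : {x : simplex d_ge2 | val x = [set i | val J i]}.
    by apply: simplexP; rewrite cJ //; have := ltn_ord k; lia.
  have dx : dim x = k by apply/eqP; rewrite -eqSS simplex_dim vx cJ.
  have [X vX] := wyth_vertex dx.
  have X0 : dim X == 0%N by apply/wyth_dim0P; exists x.
  exists (Sub X X0); apply/val_inj/ffunP => i; rewrite SubK ffunE.
  have := val_face (Sub X X0); rewrite SubK vX => /set1_inj <-.
  by rewrite vx inE.
pose g J := sval (f_surj J); have gK : cancel g f := fun J => svalP (f_surj J).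
by exists g => // X; apply: f_inj; rewrite gK.
Qed.
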